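(* Let $G$ be a graph of stability at most two and let $c$ be a proper coloring of $G$. Then $c$ is a b-coloring of $G$ if and only if the set $$M = \{uv : u,v \in V(G),\ u \neq v \text{ and } c(u)=c(v)\}$$ is a strongly maximal matching in the complement graph $\overline{G}$. Moreover, the number of colors used by $c$ is $|V(G)|-|M|$.
   Context: Graphs are finite and simple. The stability of a graph is the maximum cardinality of a set of pairwise non-adjacent vertices. $\overline{G}$ denotes the complement of $G$. A b-coloring of $G$ is a proper coloring of the vertices such that every color class contains a vertex that is adjacent to (i.e. has a neighbor in) every other color class. For a matching $M$ of a graph $H$, $V(M)$ denotes the set of vertices covered by $M$, and an augmenting path for $M$ is a path in $H$ starting and ending outside $V(M)$ whose edges alternate between $E(H)\setminus M$ and $M$. A matching $M$ of $H$ is strongly maximal if $H$ contains no augmenting path of length one or three (number of edges) with respect to $M$. *)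

(* Defs.v *)
From mathcomp Require Import all_boot.

Set Implicit Arguments.
Unset Strict Implicit.
Unset Printing Implicit Defensive.

Structure sgraph := SGraph {
  vertex :> finType;
  adj : rel vertex;
  adj_sym : symmetric adj;
  adj_irrefl : irreflexive adj }.

Section Complement.
Variable G : sgraph.

Definition compl_adj : rel G := fun u v => (u != v) && ~~ adj u v.

Lemma compl_adj_sym : symmetric compl_adj.
Proof. by move=> u v; rewrite /compl_adj eq_sym adj_sym. Qed.

Lemma compl_adj_irrefl : irreflexive compl_adj.
Proof. by move=> u; rewrite /compl_adj eqxx. Qed.

Definition compl : sgraph := SGraph compl_adj_sym compl_adj_irrefl.

End Complement.

Definition stable (G : sgraph) (S : {set G}) : bool :=
  [forall u in S, forall v in S, ~~ adj u v].

Definition stability (G : sgraph) : nat := \max_(S : {set G} | stable S) #|S|.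

Section Matchings.
Variable H : sgraph.

(* An edge is the set of its two ends. *)
Definition edges : {set {set H}} :=
  [set [set u; v] | u in H, v in H & adj u v].

(* V(M) is the library's [cover M]. *)
Definition is_matching (M : {set {set H}}) : Prop :=
  M \subset edges /\ trivIset M.

(* The edges, in order, of the path with vertices [x :: s]; the path has
   [size s] edges. *)
Definition path_edges (x : H) (s : seq H) : seq {set H} :=
  pairmap (fun u v => [set u; v]) x s.

(* Alternation: of any two consecutive edges, exactly one is in [M]. *)
Definition augmenting_path (M : {set {set H}}) (x : H) (s : seq H) : Prop :=
  [/\ path (@adj H) x s,
      uniq (x :: s),
      x \notin cover M,
      last x s \notin cover M
    & sorted (fun b1 b2 : bool => b1 != b2)
        [seq f \in M | f <- path_edges x s]].

Definition strongly_maximal_matching (M : {set {set H}}) : Prop :=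
  is_matching M /\
  ~ (exists (x : H) (s : seq H),
       augmenting_path M x s /\ (size s = 1 \/ size s = 3)).

End Matchings.

Section Colorings.
Variables (G : sgraph) (C : eqType) (c : G -> C).

Definition proper_coloring : Prop := forall u v : G, adj u v -> c u != c v.

(* Only colors attained by [c] count, so color classes are nonempty. *)
Definition used_colors : seq C := undup (codom c).

Definition num_colors : nat := size used_colors.

Definition b_coloring : Prop :=
  proper_coloring /\
  forall a, a \in used_colors ->
    exists2 u : G, c u = a &
      forall b, b \in used_colors -> b != a ->
        exists2 v : G, c v = b & adj u v.

Definition monochromatic_pairs : {set {set G}} :=
  [set [set u; v] | u in G, v in G & (u != v) && (c u == c v)].

End Colorings.

(* Main.v *)
(** In a graph of stability at most two, no vertex misses both ends of a
    non-edge, so a color class with two vertices meets the neighborhood of every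
    vertex outside it. Hence only singleton classes, i.e. the vertices outside
    [V(M)], can obstruct [c] being a b-coloring: two non-adjacent singletons form
    an augmenting path of length one, and a class [{u, v}] with [u] missing a
    singleton [x] and [v] missing a singleton [y] (then [x != y]) yields the
    augmenting path [x, u, v, y]. Conversely, these are the only shapes of
    augmenting paths of length one and three. The number of colors follows by
    counting vertices class by class, since each class has one or two elements. *)
Require Import Defs.
From mathcomp Require Import all_boot all_order all_algebra.

Set Implicit Arguments.
Unset Strict Implicit.
Unset Printing Implicit Defensive.

(** Otherwise [x], [y], [z] would form a stable set of size three. *)
Lemma stability2_adj (G : sgraph) (x y z : G) : stability G <= 2 ->
  x != y -> x != z -> y != z -> ~~ adj x y -> ~~ adj x z -> adj y z.
Proof.
move=> st2 nxy nxz nyz axy axz; apply: contraTT st2 => ayz; rewrite -ltnNge.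
have sS : stable [set x; y; z].
  apply/forall_inP => u; rewrite !inE => Hu.
  apply/forall_inP => v; rewrite !inE => Hv.
  by case/orP: Hu => [/orP[]|] /eqP ->; case/orP: Hv => [/orP[]|] /eqP ->;
    rewrite ?adj_irrefl // adj_sym.
have {1}<- : #|[set x; y; z]| = 3.
  by rewrite -setUA cardsU1 cards2 !inE nyz (negbTE nxy) (negbTE nxz).
exact: (leq_bigmax_cond (F := fun S : {set G} => #|S|)).
Qed.

Lemma mem_used_colors (G : sgraph) (C : eqType) (c : G -> C) (x : G) :
  c x \in used_colors c.
Proof. by rewrite mem_undup codom_f. Qed.

Lemma used_colorsP (G : sgraph) (C : eqType) (c : G -> C) (a : C) :
  a \in used_colors c -> exists x, a = c x.
Proof. by rewrite mem_undup => /codomP. Qed.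

Lemma mem_monochromatic_pairs (G : sgraph) (C : eqType) (c : G -> C) (x y : G) :
  ([set x; y] \in monochromatic_pairs c) = (x != y) && (c x == c y).
Proof.
apply/imset2P/idP => [[u v _] | xy]; last by exists x y; rewrite ?inE.
rewrite inE => /and3P[_ uv /eqP cuv] e.
(* The unordered pairs agree, but their ends may be swapped; comparing cardinalities, then colors on
   the whole set, avoids matching the ends. *)
have ne : x != y by have := cards2 x y; rewrite e cards2 uv; case: (x != y).
have cu z : z \in [set x; y] -> c z = c u.
  by rewrite e !inE => /orP[]/eqP ->.
by rewrite ne !cu ?inE ?eqxx ?orbT.
Qed.

Lemma cover_monochromaticP (G : sgraph) (C : eqType) (c : G -> C) (x : G) :
  reflect (exists2 y, y != x & c y = c x) (x \in cover (monochromatic_pairs c)).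
Proof.
apply: (iffP bigcupP) => [[B /imset2P[u v _]] | [y nyx cyx]].
  rewrite inE => /and3P[_ uv /eqP cuv] ->; rewrite !inE => /orP[]/eqP ->.
    by exists v; rewrite // eq_sym.
  by exists u.
by exists [set x; y]; rewrite ?mem_monochromatic_pairs ?inE ?eqxx // eq_sym nyx cyx /=.
Qed.

Section StabilityTwo.
Variables (G : sgraph) (C : eqType) (c : G -> C).
Hypotheses (st2 : stability G <= 2) (cP : proper_coloring c).
Let M := monochromatic_pairs c.
Let P := preim_partition c [set: G].

Lemma monochromatic_nadj (u v : G) : c u = c v -> ~~ adj u v.
Proof. by move=> cuv; apply/negP => /cP; rewrite cuv eqxx. Qed.

(** Color classes are stable sets, so the stability bound caps their size. *)
Lemma color_class_le2 (x y z : G) :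
  c y = c x -> c z = c x -> x != y -> x != z -> y = z.
Proof.
move=> cy cz nxy nxz; apply/eqP/negPn/negP => nyz.
have : adj y z by apply: (stability2_adj st2 nxy nxz nyz); exact: monochromatic_nadj.
by apply/negP/monochromatic_nadj; rewrite cy.
Qed.

(** Placing [M] inside the partition [P] serves twice: its edges inherit disjointness, and they can
    be counted along with the classes. *)
Lemma monochromatic_pairsE : M = [set B in P | #|B| == 2].
Proof.
apply/setP => B; rewrite inE; apply/imset2P/andP => [[u v _] | [/imsetP[x _ ->]]].
  rewrite inE => /and3P[_ uv /eqP cuv] ->; split; last by rewrite cards2 uv.
  apply/imsetP; exists u; rewrite ?inE //; apply/setP => w.
  rewrite !inE; apply/idP/eqP => [/orP[]/eqP -> // | cuw].
  case: eqVneq => //= nwu.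
  by rewrite (color_class_le2 (esym cuw) (esym cuv)) // eq_sym.
case/cards2P => u [v [uv e]].
have cE w : w \in [set u; v] -> c x = c w by rewrite -e !inE => /eqP.
by rewrite e; exists u v; rewrite // !inE uv -!cE ?inE ?eqxx ?orbT.
Qed.

(** In this form, summing over [P] splits into the number of classes plus the number of two-vertex
    classes. *)
Lemma card_color_class B : B \in P -> #|B| = 1 + (#|B| == 2).
Proof.
case/imsetP => x _ ->; set A := [set _ in _ | _].
have xA : x \in A by rewrite !inE eqxx.
have le1 : #|A :\ x| <= 1.
  apply/card_le1_eqP => y z; rewrite !inE => /andP[yx /eqP cy] /andP[zx /eqP cz].
  by apply: (@color_class_le2 x); rewrite // eq_sym.
by rewrite (cardsD1 x) xA; case: #|_| le1 => [|[]].
Qed.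

Lemma card_color_classes : #|P| = num_colors c.
Proof.
pose cls a := [set y | a == c y].
have -> : num_colors c = size (map cls (used_colors c)) by rewrite size_map.
(* [cls] is injective on used colors: a vertex of one class, tested in the other, identifies the two
   colors. *)
have /card_uniqP <- : uniq (map cls (used_colors c)).
  rewrite map_inj_in_uniq ?undup_uniq // => a b /used_colorsP[x ->] _ /setP/(_ x).
  by rewrite !inE eqxx => /esym/eqP.
apply: eq_card => B; apply/imsetP/mapP => [[x _ ->] | [a /used_colorsP[x ->] ->]].
  exists (c x); first exact: mem_used_colors.
  by apply/setP => y; rewrite !inE.
by exists x; rewrite ?inE //; apply/setP => y; rewrite !inE.
Qed.

Lemma card_vertices_colors : #|G| = num_colors c + #|M|.
Proof.
rewrite -cardsT (card_partition (preim_partitionP c _)) -/P.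
rewrite (eq_bigr _ card_color_class) big_split /= sum1_card card_color_classes.
congr (_ + _); rewrite monochromatic_pairsE -sum1_card.
rewrite [RHS](eq_bigl (fun B => (B \in P) && (#|B| == 2))) => [|B]; last by rewrite inE.
by rewrite big_mkcondr; apply: eq_bigr => B _; case: eqP.
Qed.

Lemma monochromatic_matching : is_matching (H := compl G) M.
Proof.
split.
  apply/subsetP => B /imset2P[u v _]; rewrite inE => /and3P[_ uv /eqP cuv] ->.
  apply/imset2P; exists u v; rewrite ?inE //=.
  by rewrite /compl_adj uv monochromatic_nadj.
have /and3P[_ tP _] := preim_partitionP c [set: G].
apply: trivIsetS tP; apply/subsetP => B.
by rewrite monochromatic_pairsE inE => /andP[].
Qed.

Lemma notin_coverP (x y : G) : x \notin cover M -> c y = c x -> y = x.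
Proof.
move=> /cover_monochromaticP xM cyx; apply/eqP/negPn/negP => nyx.
by case: xM; exists y.
Qed.

Lemma notin_cover_pair (x y : G) :
  x \notin cover M -> ([set x; y] \in M) = false.
Proof.
move=> xM; apply: contraNF xM => xyM.
by apply/bigcupP; exists [set x; y]; rewrite // !inE eqxx.
Qed.

(** Only uncovered vertices need testing: a covered [v] has a partner [w] of its color, not adjacent
    to it, and [u] cannot miss both. *)
Lemma b_vertexP (u : G) :
  (forall x, x \notin cover M -> x != u -> adj u x) ->
  forall v, c v != c u -> exists2 w, c w = c v & adj u w.
Proof.
move=> good v nvu.
have ne w : c w = c v -> u != w by move=> cw; apply: contraNneq nvu => ->; rewrite cw.
have [/cover_monochromaticP[w nwv cw] | vM] := boolP (v \in cover M); last first.
  by exists v; rewrite // good // eq_sym ne.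
have [uv | nuv] := boolP (adj u v); first by exists v.
exists w => //; apply: contraLR (monochromatic_nadj cw) => nuw; rewrite negbK.
by apply: (stability2_adj st2 (ne w cw) (ne v _)).
Qed.

(** The b-vertex of the class of [u] sees the color of [x], which only [x] carries when [x] is
    uncovered. *)
Lemma used_color_b_vertex (u : G) :
  b_coloring c -> exists2 w, c w = c u &
    forall x, x \notin cover M -> c x != c u -> adj w x.
Proof.
case=> _ /(_ _ (mem_used_colors c u))[w cw bw]; exists w => // x xM cxu.
have [v cv] := bw _ (mem_used_colors c x) cxu.
by rewrite (notin_coverP xM cv).
Qed.

Lemma b_coloring_no_augmenting (x : G) (s : seq G) :
  b_coloring c -> augmenting_path (H := compl G) M x s ->
  size s = 1 \/ size s = 3 -> False.
Proof.
move=> bc [pth unq xM lM srt sz].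
case: s pth unq lM srt sz => [|y [|z [|t [|r l]]]] /=; try by move=> _ _ _ _ [].
  rewrite /compl_adj => /andP[/andP[nxy nadj] _] _ yM _ _.
  (* The class of [x] is a singleton, so its b-vertex is [x] itself, which misses [y]. *)
  have [w cw bw] := used_color_b_vertex x bc.
  move: bw; rewrite (notin_coverP xM cw) => /(_ y yM) axy.
  case/negP: nadj; apply: axy; apply: contraNneq nxy => cyx.
  by rewrite (notin_coverP xM cyx).
rewrite /compl_adj => /and4P[/andP[nxy naxy] _ /andP[nzt nazt] _] _ tM.
(* The first edge leaves an uncovered vertex, hence is not in [M]; alternation puts the middle edge
   [yz] in [M]. *)
rewrite (notin_cover_pair y xM) => /andP[+ _] _.
rewrite eq_sym eqbF_neg negbK mem_monochromatic_pairs => /andP[nyz /eqP cyz].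
(* This b-vertex is [y] or [z], yet [y] misses [x] and [z] misses [t]. *)
have [w cw bw] := used_color_b_vertex y bc.
have axw : adj w x.
  by apply: bw => //; apply: contraNneq nxy => e; rewrite (notin_coverP xM (esym e)).
have awt : adj w t.
  apply: bw => //; apply: contraNneq nzt => e.
  by rewrite (notin_coverP tM (etrans (esym cyz) (esym e))).
have [e | nwy] := eqVneq w y; first by rewrite -e adj_sym axw in naxy.
have ezw : z = w by apply: (@color_class_le2 y); rewrite // eq_sym.
by rewrite ezw awt in nazt.
Qed.

Lemma no_augmenting_b_coloring :
  (forall x s, augmenting_path (H := compl G) M x s ->
     size s = 1 \/ size s = 3 -> False) -> b_coloring c.
Proof.
move=> noaug; split=> // a /used_colorsP[u ->].
suff [w cw gw] : exists2 w, c w = c u &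
    forall x, x \notin cover M -> x != w -> adj w x.
  exists w => // b /used_colorsP[v ->] nvu.
  by have [|z cz az] := b_vertexP gw (v := v); rewrite ?cw //; exists z.
pose good w := [forall x, (x \notin cover M) && (x != w) ==> adj w x].
have goodP w : good w -> forall x, x \notin cover M -> x != w -> adj w x.
  by move=> /forallP gw x xM xw; have /implyP := gw x; rewrite xM xw; apply.
have badP w : ~~ good w -> exists x, [/\ x \notin cover M, x != w & ~~ adj w x].
  by case/forallPn => x; rewrite negb_imply => /andP[/andP[]]; exists x.
have [gu | /badP[x [xM nxu aux]]] := boolP (good u); first by exists u => //; apply: goodP.
have [/cover_monochromaticP[v nvu cvu] | uM] := boolP (u \in cover M); last first.
  case: (noaug u [:: x]) => //; last by left.
  split=> //=; first by rewrite /compl_adj eq_sym nxu aux.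
  by rewrite inE andbT eq_sym.
have [gv | /badP[y [yM nyv avy]]] := boolP (good v); first by exists v => //; apply: goodP.
have uvM : [set u; v] \in M by rewrite mem_monochromatic_pairs eq_sym nvu cvu /=.
have covered z w : [set z; w] \in M -> z \in cover M.
  by move=> zwM; apply: contraTT zwM => /notin_cover_pair ->.
have uM := covered _ _ uvM.
have vM : v \in cover M by apply: (covered v u); rewrite setUC.
have nxv : x != v by apply: contraNneq xM => ->.
have nyu : y != u by apply: contraNneq yM => ->.
(* If [x] were [y], then [u] would miss both [v] and [x], forcing [v] to be adjacent to [x], that
   is, to [y]. *)
have nxy : x != y.
  apply: contraNneq avy => <-; apply: (stability2_adj st2 _ _ _ _ aux);
    rewrite 1?eq_sym //.
  by rewrite adj_sym monochromatic_nadj.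
case: (noaug x [:: u; v; y]) => //; last by right.
split=> //=.
- by rewrite /compl_adj nxu adj_sym aux eq_sym nvu monochromatic_nadj // eq_sym nyv avy.
- by rewrite !inE !negb_or nxu nxv nxy eq_sym nvu eq_sym nyu eq_sym nyv.
- by rewrite notin_cover_pair // uvM setUC notin_cover_pair.
Qed.

End StabilityTwo.

Import GRing.Theory.
Local Open Scope ring_scope.

(** The count is stated over the integers so that the subtraction is not truncated. *)
Theorem lemma2 (G : sgraph) (C : eqType) (c : G -> C) :
  (stability G <= 2)%N ->
  proper_coloring c ->
  (b_coloring c <->
     strongly_maximal_matching (H := compl G) (monochromatic_pairs c)) /\
  (num_colors c)%:Z = #|G|%:Z - #|monochromatic_pairs c|%:Z.
Proof.
move=> st2 cP; split; last by rewrite (card_vertices_colors st2 cP) PoszD addrK.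
split=> [bc | [_ noaug]].
  split; first exact: monochromatic_matching.
  by case=> x [s [aug sz]]; exact: (b_coloring_no_augmenting st2 cP bc aug sz).
by apply: no_augmenting_b_coloring => // x s aug sz; apply: noaug; exists x, s.
Qed.
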